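(* Let $D,N$ be integers with $D\ge 1$ and $D+1<N$. Let $\mathcal{C}$ be the binary linear code with parity-check matrix $M(D,D+1,N)$. Then the minimum distance of $\mathcal{C}$ is $d_{\min}(\mathcal{C})=D+2$.
   Context: Write $[N]=\{1,\dots,N\}$. For integers $D<K<N$, $M(D,K,N)$ is the $\binom{N}{D}\times\binom{N}{K}$ binary matrix whose rows are indexed by the $D$-element subsets of $[N]$ and whose columns are indexed by the $K$-element subsets of $[N]$, with a $1$ in position $(S,U)$ if and only if $S\subseteq U$. The binary code with parity-check matrix $H$ (with $n$ columns) is $\{\mathbf{x}\in\mathbb{F}_2^n : H\mathbf{x}^T=\mathbf{0}\}$. The minimum distance of a linear code is the minimum Hamming weight of a nonzero codeword. *)

(* Defs.v *)
From mathcomp Require Import all_boot all_order all_algebra.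

Set Implicit Arguments.
Unset Strict Implicit.
Unset Printing Implicit Defensive.

Import GRing.Theory.
Local Open Scope ring_scope.

(* The ground set [N] = {1, ..., N} is represented by 'I_N = {0, ..., N-1}. *)
Definition ksubsets (N K : nat) : {set {set 'I_N}} :=
  [set S : {set 'I_N} | #|S| == K].

Lemma card_ksubsets (N K : nat) : #|ksubsets N K| = 'C(N, K).
Proof. by rewrite card_draws card_ord. Qed.

(* By card_ksubsets this is a 'C(N, D) x 'C(N, K) matrix; enum_val turns row
   and column indices into the corresponding subsets. *)
Definition inclusion_mx (D K N : nat) :
    'M['F_2]_(#|ksubsets N D|, #|ksubsets N K|) :=
  \matrix_(i < #|ksubsets N D|, j < #|ksubsets N K|)
    ((enum_val i : {set 'I_N}) \subset (enum_val j : {set 'I_N}))%:R.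

Definition code_of_parity_check (m n : nat) (H : 'M['F_2]_(m, n)) :
    {set 'rV['F_2]_n} :=
  [set x : 'rV['F_2]_n | H *m x^T == 0].

Definition hamming_weight (n : nat) (x : 'rV['F_2]_n) : nat :=
  #|[set i : 'I_n | x 0 i != 0]|.

(* A relation rather than a function to nat: the zero code has no minimum
   distance, and this avoids choosing a junk value for it. *)
Definition is_min_distance (n : nat) (C : {set 'rV['F_2]_n}) (d : nat) : Prop :=
  (exists x : 'rV['F_2]_n, [/\ x \in C, x != 0 & hamming_weight x = d]) /\
  (forall x : 'rV['F_2]_n, x \in C -> x != 0 -> (d <= hamming_weight x)%N).

(* Main.v *)
(** The support of a word is read as a family of (D+1)-sets; it is a codeword
    iff every D-set lies in an even number of members.  If [U] is a member and
    [u] is in [U], then [U :\ u] must lie in a second member [W], for which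
    [U :\: W = [set u]]; this gives D+1 distinct members besides [U].
    Conversely, the D+2 subsets [T :\ t] of a (D+2)-set [T] form a codeword:
    a D-set [S] contained in [T] lies in exactly two of them. *)

Require Import Defs.
From mathcomp Require Import all_boot all_order all_algebra.

Import GRing.Theory.
Local Open Scope ring_scope.

Definition support_family {N K : nat} (x : 'rV['F_2]_#|ksubsets N K|) :
    {set {set 'I_N}} :=
  [set enum_val j | j in [set j | x 0 j != 0]].

Lemma card_support_family {N K : nat} (x : 'rV['F_2]_#|ksubsets N K|) :
  #|support_family x| = hamming_weight x.
Proof. by rewrite card_imset //; apply: enum_val_inj. Qed.

Lemma card_in_support_family {N K : nat} (x : 'rV['F_2]_#|ksubsets N K|) U :
  U \in support_family x -> #|U| = K.
Proof.
by case/imsetP=> j _ ->; have := enum_valP j; rewrite inE => /eqP.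
Qed.

Lemma support_family_neq0 {N K : nat} (x : 'rV['F_2]_#|ksubsets N K|) :
  x != 0 -> support_family x != set0.
Proof.
case/rV0Pn=> j xj_neq0; apply/set0Pn; exists (enum_val j).
by apply/imset_f; rewrite inE.
Qed.

(** The indicator vector of [F] does it; this lets a codeword be given by its family of sets. *)
Lemma support_family_surj {N K : nat} (F : {set {set 'I_N}}) :
  F \subset ksubsets N K ->
  exists x : 'rV['F_2]_#|ksubsets N K|, support_family x = F.
Proof.
move=> sFK; exists (\row_j (enum_val j \in F)%:R).
apply/setP=> U; apply/imsetP/idP => [[j + ->]|FU].
  by rewrite inE mxE; case: (_ \in F).
have KU := subsetP sFK U FU.
by exists (enum_rank_in KU U); rewrite ?inE ?mxE enum_rankK_in // FU.
Qed.

Lemma F2_boolE (a : 'F_2) : a = (a != 0)%:R.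
Proof. by case: a => [[|[|//]]] lt_a2; apply/val_inj. Qed.

Lemma F2_natr_eq0 n : (n%:R == 0 :> 'F_2) = ~~ odd n.
Proof. by rewrite -(dvdn_pcharf (pchar_Fp (isT : prime 2))) dvdn2. Qed.

(** Over ['F_2] every nonzero coordinate is 1, so a sum of products with 0/1 entries is a count
    modulo 2. *)
Lemma inclusion_syndrome {D K N : nat} (x : 'rV['F_2]_#|ksubsets N K|) i :
  (inclusion_mx D K N *m x^T) i 0 =
    #|[set U in support_family x | enum_val i \subset U]|%:R.
Proof.
have -> : [set U in support_family x | enum_val i \subset U] =
    [set enum_val j | j in [set j | (x 0 j != 0) && (enum_val i \subset enum_val j)]].
  apply/setP=> U; rewrite inE; apply/andP/imsetP => [[/imsetP[j + ->] siU]|].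
    by rewrite inE => xj; exists j; rewrite // inE xj.
  by case=> j; rewrite inE => /andP[xj sij] ->; rewrite imset_f ?inE.
rewrite card_imset; last exact: enum_val_inj.
rewrite mxE -[in RHS]sum1_card natr_sum [RHS]big_mkcond; apply: eq_bigr => j _ /=.
rewrite !mxE inE {1}[x 0 j]F2_boolE -natrM mulnb andbC.
by case: (_ && _).
Qed.

Lemma inclusion_codeP {D K N : nat} (x : 'rV['F_2]_#|ksubsets N K|) :
  reflect (forall S : {set 'I_N}, #|S| = D ->
             ~~ odd #|[set U in support_family x | S \subset U]|)
          (x \in code_of_parity_check (inclusion_mx D K N)).
Proof.
rewrite inE; apply: (iffP eqP) => [Hx S cardS | even_x].
  have DS : S \in ksubsets N D by rewrite inE cardS.
  have := inclusion_syndrome x (enum_rank_in DS S).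
  by rewrite Hx mxE enum_rankK_in // -F2_natr_eq0 => <-.
apply/matrixP=> i k; rewrite ord1 inclusion_syndrome mxE; apply/eqP.
rewrite F2_natr_eq0; apply: even_x.
by have := enum_valP i; rewrite inE => /eqP.
Qed.

Lemma even_family_card {T : finType} (D : nat) (F : {set {set T}}) :
  (forall U, U \in F -> #|U| = D.+1) ->
  (forall S : {set T}, #|S| = D -> ~~ odd #|[set U in F | S \subset U]|) ->
  F != set0 -> (D.+2 <= #|F|)%N.
Proof.
move=> cardF evenF /set0Pn[U FU].
(* [D.+1] is counted as the number of singletons [[set u]] with [u] in [U]. It suffices that all of
   them lie in the image of [F :\ U] under [W => U :\: W], which avoids choosing a [W] for each
   [u]. *)
rewrite (cardsD1 U) FU ltnS -(cardF U FU) -(card_imset (mem U) set1_inj).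
apply: leq_trans (leq_imset_card (fun W => U :\: W) _).
apply/subset_leq_card/subsetP=> _ /imsetP[u Uu ->].
have cardUu : #|U :\ u| = D.
  by apply/succn_inj; rewrite -(cardF U FU) (cardsD1 u U) Uu.
(* [U] itself contains [U :\ u], so the number of other members containing it is odd, hence
   positive. *)
have := evenF _ cardUu; rewrite (cardsD1 U) inE FU subsetDl /= negbK => odd_rest.
have /card_gt0P[W] := odd_gt0 odd_rest.
rewrite !inE => /and3P[neqWU FW sUuW]; apply/imsetP; exists W.
  by rewrite !inE neqWU.
have nsUW : ~~ (U \subset W).
  apply: contraNN neqWU => sUW.
  by rewrite eq_sym eqEcard sUW (cardF W FW) (cardF U FU) leqnn.
apply/esym/eqP; move: nsUW; rewrite -setD_eq0 => /set0Pn[v UWv].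
have sUWu : U :\: W \subset [set u] by rewrite subDset setUC -subDset.
by move: sUWu; rewrite subset1 => /orP[//|/eqP UW0]; rewrite UW0 inE in UWv.
Qed.

(** The removed point is the only element of [A] missing from [A :\ t]. *)
Lemma setD1_inj {T : finType} (A : {set T}) : {in A &, injective (fun t => A :\ t)}.
Proof.
move=> s t As At /setP/(_ s).
by rewrite !inE eqxx As !andbT => /esym/negbFE /eqP.
Qed.

Lemma even_simplex_boundary {T : finType} (D : nat) (A S : {set T}) :
  #|A| = D.+2 -> #|S| = D ->
  ~~ odd #|[set U in [set A :\ t | t in A] | S \subset U]|.
Proof.
move=> cardA cardS; have [sSA|nsSA] := boolP (S \subset A); last first.
  rewrite (_ : [set _ in _ | _] = set0) ?cards0 //.
  apply/setP=> U; rewrite !inE; apply/negP=> /andP[/imsetP[t _ ->]].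
  by move/subset_trans/(_ (subsetDl _ _)); apply/negP.
(* [A :\ t] contains [S] exactly when [t] is outside [S], and [A :\: S] has two elements. *)
have -> : [set U in [set A :\ t | t in A] | S \subset U] =
    [set A :\ t | t in A :\: S].
  apply/setP=> U; rewrite inE; apply/andP/imsetP => [[/imsetP[t At ->]]|[t]].
    by rewrite subsetD1 sSA /= => nSt; exists t; rewrite // inE nSt.
  by rewrite inE => /andP[nSt At] ->; split; [apply: imset_f | rewrite subsetD1 sSA].
rewrite card_in_imset; last first.
  by apply: sub_in2 (setD1_inj A) => t /setDP[].
by rewrite cardsD (setIidPr sSA) cardA cardS -addn2 addKn.
Qed.

Theorem theorem3p8 (D N : nat) (hD : (1 <= D)%N) (hN : (D + 1 < N)%N) :
  is_min_distance (code_of_parity_check (inclusion_mx D (D + 1) N)) (D + 2)%N.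
Proof.
split; last first.
  move=> x /inclusion_codeP even_x x_neq0; rewrite addn2 -card_support_family.
  apply: even_family_card even_x (support_family_neq0 _ x_neq0) => U.
  by move/card_in_support_family; rewrite addn1.
have [A cardA] : exists A : {set 'I_N}, #|A| = D.+2.
  (* [hN] says [D.+2 <= N], so the binomial coefficient is positive. *)
  rewrite addn1 in hN; have /card_gt0P[A] : (0 < #|ksubsets N D.+2|)%N.
    by rewrite card_ksubsets bin_gt0.
  by rewrite inE => /eqP; exists A.
have [|x supp_x] := @support_family_surj N (D + 1) [set A :\ t | t in A].
  apply/subsetP=> _ /imsetP[t At ->]; rewrite inE addn1 -eqSS -cardA.
  by rewrite (cardsD1 t A) At.
have wt_x : hamming_weight x = (D + 2)%N.
  rewrite -card_support_family supp_x card_in_imset ?cardA ?addn2 //.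
  exact: setD1_inj.
exists x; split=> //.
  by apply/inclusion_codeP=> S cardS; rewrite supp_x (even_simplex_boundary D).
(* The zero word has weight 0, which is not [D.+2]. *)
apply/eqP=> x0; move: wt_x; rewrite x0 /hamming_weight addn2.
by rewrite (_ : [set _ | _] = set0) ?cards0 //; apply/setP=> i; rewrite !inE mxE eqxx.
Qed.
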